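(* Let $h>0$, let $A_h=\frac{1}{h^2}\begin{bmatrix}&-1&\\-1&4&-1\\&-1&\end{bmatrix}$ be the five-point discrete Laplacian on the infinite two-dimensional grid $h\mathbb{Z}^2$, let $M_v$ be the vertex-wise additive Vanka operator for $A_h$, and let $S_v=I-\omega M_vA_h$, $\omega\in\mathbb{R}$. Let $\widetilde{A}_h(\boldsymbol\theta)$ and $\widetilde{M}_v(\boldsymbol\theta)$, $\boldsymbol\theta=(\theta_1,\theta_2)$, denote the symbols of $A_h$ and $M_v$, and let $T^{\rm high}=[-\frac{\pi}{2},\frac{3\pi}{2})^2\setminus[-\frac{\pi}{2},\frac{\pi}{2})^2$. Then the optimal smoothing factor of $S_v$ is $$\mu_{\rm opt}=\min_{\omega\in\mathbb{R}}\ \max_{\boldsymbol\theta\in T^{\rm high}}\left|1-\omega\,\widetilde{M}_v(\boldsymbol\theta)\widetilde{A}_h(\boldsymbol\theta)\right|=\frac{9}{23},$$ and the minimum over $\omega$ is uniquely achieved at $\omega=\frac{20}{23}$.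
   Context: Grid functions are functions $u:h\mathbb{Z}^2\to\mathbb{C}$. A stencil $[s_{\boldsymbol k}]_{\boldsymbol k\in\mathbb{Z}^2}$ (finitely many nonzero entries, the centre entry being $\boldsymbol k=0$) defines the operator $(Su)(\boldsymbol x)=\sum_{\boldsymbol k} s_{\boldsymbol k}\,u(\boldsymbol x+h\boldsymbol k)$. The symbol of such an operator $S$ is the function $\widetilde{S}(\boldsymbol\theta)$ with $S e^{\iota\boldsymbol\theta\cdot\boldsymbol x/h}=\widetilde{S}(\boldsymbol\theta)e^{\iota\boldsymbol\theta\cdot\boldsymbol x/h}$, where $\iota^2=-1$. Additive Vanka operator: given a family of finite subsets (patches) $\Upsilon_i$ of the grid whose union is the whole grid, let $V_i$ be the restriction of a grid function to $\Upsilon_i$, $V_i^T$ its transpose (extension by zero), and $A_i=V_iA_hV_i^T$. Then $M=\sum_i V_i^T W_i A_i^{-1}V_i$, where $W_i$ is the diagonal matrix whose entry at each grid point of $\Upsilon_i$ is the reciprocal of the number of patches containing that grid point. The vertex-wise Vanka operator $M_v$ in two dimensions uses as patches each grid point together with its four nearest neighbours, $\{\boldsymbol x-(0,h),\ \boldsymbol x-(h,0),\ \boldsymbol x,\ \boldsymbol x+(h,0),\ \boldsymbol x+(0,h)\}$, $\boldsymbol x\in h\mathbb{Z}^2$ (so, in this ordering, $A_i=\frac{1}{h^2}\begin{pmatrix}4&0&-1&0&0\\0&4&-1&0&0\\-1&-1&4&-1&-1\\0&0&-1&4&0\\0&0&-1&0&4\end{pmatrix}$ and $W_i=\frac15 I$).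 *)

(* Defs.v *)
From HB Require Import structures.
From mathcomp Require Import all_boot all_order all_algebra finmap.
From mathcomp Require Import all_classical all_reals all_analysis.
From mathcomp Require Import complex.

Set Implicit Arguments.
Unset Strict Implicit.
Unset Printing Implicit Defensive.

Import Order.TTheory GRing.Theory Num.Theory.
Import ComplexField.Normc.

Local Open Scope classical_set_scope.
Local Open Scope fset_scope.
Local Open Scope complex_scope.
Local Open Scope ring_scope.

(* The index k stands for the point h k of the grid h Z^2, see [gridpt]. *)
Notation grid := (int * int)%type.

Section Grid.
Variables (R : realType) (h : R).

Definition gridfun : Type := grid -> R[i].
Definition operator : Type := gridfun -> gridfun.

Definition gridpt (k : grid) : R * R := (h * k.1%:~R, h * k.2%:~R).

(* exp (i t) for real t *)
Definition expi (t : R) : R[i] := cos t +i* sin t.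

Definition fourier_mode (theta : R * R) : gridfun := fun k =>
  expi ((theta.1 * (gridpt k).1 + theta.2 * (gridpt k).2) / h).

(* The eigenvalue of S on the Fourier mode of frequency theta; it is unique
   since modes do not vanish.  The value is 0 if the mode is not an
   eigenfunction of S. *)
Definition symbol (S : operator) (theta : R * R) : R[i] :=
  xget 0 [set s : R[i] |
    forall x, S (fourier_mode theta) x = s * fourier_mode theta x].

(* [\sum_(k \in setT)] is the sum over the finitely many k whose term is
   nonzero. *)
Definition stencil_op (s : grid -> R[i]) : operator := fun u x =>
  \sum_(k \in [set: grid]) s k * u (x + k).

Definition laplacian_stencil (k : grid) : R[i] :=
  (h ^- 2)%:C *
  (if k == 0 then 4
   else if k \in [:: (1, 0); (-1, 0); (0, 1); (0, -1)] then -1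
   else 0).

Definition Ah : operator := stencil_op laplacian_stencil.

Section Vanka.
Variables (A : operator) (I : choiceType) (Y : I -> {fset grid}).

Definition restrict (i : I) (u : gridfun) : 'cV[R[i]]_(#|` Y i|) :=
  \col_j u (Y i)`_j.

Definition extend (i : I) (v : 'cV[R[i]]_(#|` Y i|)) : gridfun := fun x =>
  \sum_(j < #|` Y i| | (Y i)`_j == x) v j 0.

(* The matrix of the linear map V_i A V_i^T. *)
Definition patch_mx (i : I) : 'M[R[i]]_(#|` Y i|) :=
  \matrix_(j, k) restrict i (A (extend (delta_mx k 0))) j 0.

Definition nb_patches (x : grid) : nat :=
  #|` fset_set [set i : I | x \in Y i]|.

Definition patch_weights (i : I) : 'M[R[i]]_(#|` Y i|) :=
  diag_mx (\row_j ((nb_patches (Y i)`_j)%:R)^-1).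

(* For each x, only the patches containing x contribute; there should be
   finitely many of them. *)
Definition additive_vanka : operator := fun u x =>
  \sum_(i \in [set: I])
    extend (patch_weights i *m invmx (patch_mx i) *m restrict i u) x.

End Vanka.

Definition vertex_patch (x : grid) : {fset grid} :=
  [fset (x - (0, 1))%R; (x - (1, 0))%R; x; (x + (1, 0))%R; (x + (0, 1))%R].

Definition Mv : operator := additive_vanka Ah vertex_patch.

Definition Sv (omega : R) : operator := fun u x =>
  u x - omega%:C * Mv (Ah u) x.

End Grid.

Definition box (R : realType) (a b : R) : set (R * R) :=
  [set theta | a <= theta.1 < b /\ a <= theta.2 < b].

Definition Thigh (R : realType) : set (R * R) :=
  box (- (pi / 2)) (3 * pi / 2) `\` box (- (pi / 2)) (pi / 2).

Definition is_max (R : realType) (A : set R) (m : R) : Prop :=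
  A m /\ ubound A m.

Definition is_min (R : realType) (A : set R) (m : R) : Prop :=
  A m /\ lbound A m.

(* Main.v *)
(* Every patch matrix is h^-2 times the same 5x5 star matrix, whose inverse is
   explicit, so M_v becomes a stencil operator.  With s = cos theta_1 + cos theta_2
   one finds A~ = (4 - 2 s) / h^2 and M~ = h^2 (16 + 4 s + s^2) / 60, hence
   M~ A~ = (2 - s) (16 + 4 s + s^2) / 30.  On T^high, s ranges over [-2, 1], with
   both ends attained, at (pi, pi) and (pi/2, 0), and there the product lies
   between its end values 8/5 and 7/10.  So the maximum is
   max (|1 - 7/10 omega|, |1 - 8/5 omega|), which is least exactly where the two
   terms balance, at omega = 20/23. *)

Require Import Defs.
From mathcomp Require Import all_boot all_order all_algebra.
From mathcomp Require Import all_classical all_reals all_analysis.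
From mathcomp Require Import complex finmap ring lra.
Import ComplexField.Normc.
Import Order.TTheory GRing.Theory Num.Theory.

Local Open Scope classical_set_scope.
Local Open Scope fset_scope.
Local Open Scope complex_scope.
Local Open Scope ring_scope.

Set Implicit Arguments.
Unset Strict Implicit.

(** * Additive Vanka operators of stencil operators, for arbitrary finite patches *)

Section PatchOperators.
Variables (R : realType) (I : choiceType) (Y : I -> {fset grid}).

Lemma big_fset_ord (V : nmodType) (X : {fset grid}) (F : grid -> V) :
  \sum_(j < #|` X|) F X`_j = \sum_(x <- X) F x.
Proof. by rewrite [RHS](big_nth 0) big_mkord. Qed.

(** The points of a patch are pairwise distinct, so at most one index [j] contributes at [x]. *)
Lemma extend_col (i : I) (f : grid -> R[i]) (x : grid) :
  @extend R I Y i (\col_j f (Y i)`_j) x = if x \in Y i then f x else 0.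
Proof.
rewrite /extend; under eq_bigr do rewrite mxE.
rewrite big_mkcond /=.
rewrite (big_fset_ord (Y i) (fun y => if y == x then f y else 0)).
rewrite -big_mkcond /= -big_filter.
case: ifPn => xY; first by rewrite filter_pred1_uniq ?fset_uniq// big_seq1.
by rewrite (eq_in_filter (a2 := pred0)) ?filter_pred0 ?big_nil// => y yY;
  apply: contraNF xY => /eqP<-.
Qed.

Lemma stencil_op_extend_delta (s : grid -> R[i]) (i : I) (k : 'I_#|` Y i|)
    (x : grid) :
  stencil_op s (@extend R I Y i (delta_mx k 0)) x = s ((Y i)`_k - x).
Proof.
have -> : delta_mx k 0
          = \col_(j < #|` Y i|) ((Y i)`_j == (Y i)`_k)%:R :> 'cV[R[i]]_#|` Y i|.
  apply/matrixP => j l; rewrite !mxE ord1 eqxx andbT.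
  by rewrite nth_uniq ?fset_uniq.
pose f y : R[i] := (y == (Y i)`_k)%:R.
rewrite /stencil_op (@fsbigTE _ _ _ _ [fset (Y i)`_k - x]).
  by rewrite big_seq_fset1 subrKC (extend_col _ f) mem_nth// /f eqxx mulr1.
move=> z; rewrite inE => zN; rewrite (extend_col _ f) /f.
case: ifP => _; rewrite ?mulr0//.
case: eqP => [E|_]; rewrite ?mulr0//.
by move: zN; rewrite -E addrC addKr eqxx.
Qed.

(** A right inverse of a square matrix is its inverse, so one product has to be checked. Indexing
    [b] by grid points makes the check independent of the order in which [Y i] is enumerated. *)
Lemma invmx_patch_mx (s : grid -> R[i]) (b : grid -> grid -> R[i]) (i : I) :
  {in Y i &, forall x z, \sum_(y <- Y i) s (y - x) * b y z = (x == z)%:R} ->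
  invmx (patch_mx (stencil_op s) Y i) = \matrix_(j, k) b (Y i)`_j (Y i)`_k.
Proof.
move=> sb; set B := RHS.
have AB : patch_mx (stencil_op s) Y i *m B = 1%:M.
  apply/matrixP => j k; rewrite !mxE.
  under eq_bigr do rewrite !mxE stencil_op_extend_delta.
  rewrite (big_fset_ord (Y i) (fun y => s (y - (Y i)`_j) * b y (Y i)`_k)).
  by rewrite sb ?mem_nth// nth_uniq ?fset_uniq.
have [Au _] := mulmx1_unit AB.
by rewrite -[RHS](mulKmx Au) AB mulmx1.
Qed.

Lemma additive_vankaE (s : grid -> R[i]) (b : I -> grid -> grid -> R[i]) :
  (forall i, {in Y i &, forall x z,
    \sum_(y <- Y i) s (y - x) * b i y z = (x == z)%:R}) ->
  forall u x, additive_vanka (stencil_op s) Y u x =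
    \sum_(i \in [set: I]) if x \in Y i then
      (nb_patches Y x)%:R^-1 * \sum_(y <- Y i) b i x y * u y else 0.
Proof.
move=> sb u x; apply: eq_fsbigr => i _.
rewrite -(extend_col i (fun x => (nb_patches Y x)%:R^-1 *
  \sum_(y <- Y i) b i x y * u y)).
congr (extend _ x); apply/colP => j.
rewrite (invmx_patch_mx (sb i)).
rewrite -mulmxA mul_diag_mx !mxE; congr (_ * _).
rewrite -(big_fset_ord (Y i) (fun y => b i (Y i)`_j y * u y)).
by apply: eq_bigr => k _; rewrite !mxE.
Qed.

End PatchOperators.

(** * The five-point star and its translates *)

Definition star : seq grid := [:: 0; (1, 0); (-1, 0); (0, 1); (0, -1)].

Lemma vertex_patch_perm (x : grid) :
  perm_eq (vertex_patch x) [seq x + d | d <- star].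
Proof.
apply: uniq_perm; rewrite ?fset_uniq ?(map_inj_uniq (addrI _))// => y.
rewrite !inE /= addr0.
have -> : x - (0, 1) = x + (0, -1) by [].
have -> : x - (1, 0) = x + (-1, 0) by [].
by do 5?[case: (y == _)]; rewrite ?orbT.
Qed.

Lemma sum_vertex_patch (V : nmodType) (F : grid -> V) (x : grid) :
  \sum_(y <- vertex_patch x) F y = \sum_(d <- star) F (x + d).
Proof. by rewrite (perm_big _ (vertex_patch_perm x)) big_map. Qed.

Lemma mem_vertex_patch (x y : grid) : (y \in vertex_patch x) = (y - x \in star).
Proof.
rewrite (perm_mem (vertex_patch_perm x)) -[in LHS](subrKC x y).
by rewrite (mem_map (addrI x)).
Qed.

Lemma mem_starN (d : grid) : (- d \in star) = (d \in star).
Proof.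
rewrite !inE !(can2_eq opprK opprK) oppr0.
have -> : - (1, 0) = (-1, 0) :> grid by [].
have -> : - (-1, 0) = (1, 0) :> grid by [].
have -> : - (0, 1) = (0, -1) :> grid by [].
have -> : - (0, -1) = (0, 1) :> grid by [].
by do 5?[case: (d == _)]; rewrite ?orbT.
Qed.

Lemma mem_vertex_patchC (x y : grid) :
  (y \in vertex_patch x) = (x \in vertex_patch y).
Proof. by rewrite !mem_vertex_patch -mem_starN opprB. Qed.

(** The star is symmetric about 0, so the patches containing [x] are those centred at the points of
    [vertex_patch x]. *)
Lemma nb_patches_vertex (x : grid) : nb_patches vertex_patch x = 5%N.
Proof.
rewrite /nb_patches.
have -> : [set i | x \in vertex_patch i] = [set` vertex_patch x].
  by apply/seteqP; split=> y /=; rewrite mem_vertex_patchC.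
by rewrite set_fsetK (perm_size (vertex_patch_perm x)).
Qed.

(** Decides equalities of concrete grid points by computation, so that the conditionals on them
    reduce and [field] meets only numbers. *)
Ltac eval_grid_eq := repeat match goal with
  |- context [@eq_op ?T ?a ?b] =>
    let v := eval vm_compute in (@eq_op T a b) in
    change (@eq_op T a b) with v end; cbn iota.

(** * Stencil form of the vertex-wise Vanka operator *)

Section VertexVanka.
Variables (R : realType) (h : R).
Hypothesis h_neq0 : h != 0.
Local Notation hC := (h%:C).

Lemma AhE (u : gridfun R) x :
  Ah h u x = \sum_(d <- star) laplacian_stencil h d * u (x + d).
Proof.
rewrite /Ah /stencil_op (@fsbigTE _ _ _ _ (vertex_patch 0)).
  by rewrite sum_vertex_patch; under eq_bigr do rewrite add0r.
move=> k; rewrite mem_vertex_patch subr0 => kN.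
rewrite /laplacian_stencil; move: kN; rewrite !inE.
by case/norP => /negPf-> /negPf->; rewrite mulr0 mul0r.
Qed.

(* The inverse of the 5x5 matrix A_i is [h ^ 2 * star_inv]. *)
Definition star_inv (d e : grid) : R[i] :=
  if (d == 0) && (e == 0) then 1 / 3
  else if (d == 0) || (e == 0) then 1 / 12
  else (d == e)%:R / 4 + 1 / 48.

(** Eliminating the four outer points leaves the Schur complement 4 - 4/4 = 3 at the centre. This
    gives the entries 1/3, then 1/12 = 1/3 * 1/4, and the rank-one term 1/48 = 1/3 * 1/16 added to
    the diagonal 1/4. All 25 entries are checked separately. *)
Lemma star_invP : {in star &, forall d f,
  \sum_(e <- star) laplacian_stencil h (e - d) * (hC ^+ 2 * star_inv e f)
  = (d == f)%:R}.
Proof.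
have hC0 : hC != 0 by rewrite fmorph_eq0.
move=> d f; rewrite /star !big_cons big_nil /laplacian_stencil /star_inv !inE.
rewrite fmorphV rmorphXn.
by move=> /or4P[||| /orP[]] /eqP-> /or4P[||| /orP[]] /eqP->;
  eval_grid_eq; cbn [andb orb negb nat_of_bool]; field.
Qed.

(** The patches containing [x] are centred at [x + d] with [d] in the star. Seen from that centre,
    [x] has offset [- d] and the other index of the inverse is [e]; the 1/5 is the weight. *)
Lemma MvE (u : gridfun R) x : Mv h u x =
  \sum_(d <- star) \sum_(e <- star)
    hC ^+ 2 / 5 * star_inv (- d) e * u (x + d + e).
Proof.
rewrite /Mv /Ah.
rewrite (@additive_vankaE _ _ _ _
  (fun i y z => hC ^+ 2 * star_inv (y - i) (z - i))); last first.
  move=> i y z; rewrite !mem_vertex_patch sum_vertex_patch => yi zi.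
  rewrite -(inj_eq (addIr (- i)) y z) -star_invP//.
  by apply: eq_bigr => e _; rewrite [i + e]addrC addrK opprB addrA.
rewrite (@fsbigTE _ _ _ _ (vertex_patch x)); last first.
  by move=> i; rewrite mem_vertex_patchC => /negPf->.
rewrite sum_vertex_patch; apply: eq_big_seq => d dstar.
have xd : x - (x + d) = - d by rewrite opprD addNKr.
rewrite mem_vertex_patch xd mem_starN dstar nb_patches_vertex.
rewrite sum_vertex_patch mulr_sumr; apply: eq_bigr => e _.
rewrite [x + d + e]addrC addrK; ring.
Qed.

(** * Fourier modes and symbols *)

Lemma fourier_mode0 theta : fourier_mode h theta 0 = 1.
Proof.
by rewrite /fourier_mode /gridpt /expi /= !mulr0 addr0 mul0r cos0 sin0.
Qed.

Lemma fourier_modeD theta x y :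
  fourier_mode h theta (x + y) = fourier_mode h theta x * fourier_mode h theta y.
Proof.
rewrite /fourier_mode /gridpt /expi /= !rmorphD/=.
set a := _ / h; set b := _ / h; set c := _ / h.
have -> : a = b + c by rewrite /a /b /c; ring.
rewrite cosD sinD; simpc; congr (_ +i* _); ring.
Qed.

Lemma symbol_eigen (S : operator R) theta c :
  (forall x, S (fourier_mode h theta) x = c * fourier_mode h theta x) ->
  symbol h S theta = c.
Proof.
move=> Sc; rewrite /symbol.
have := @xgetPex _ 0 _ (ex_intro [set s | forall x, _ = s * _] c Sc).
by move=> /(_ 0); rewrite Sc fourier_mode0 !mulr1.
Qed.

Definition Ah_symbol theta : R[i] :=
  \sum_(d <- star) laplacian_stencil h d * fourier_mode h theta d.

Definition Mv_symbol theta : R[i] :=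
  \sum_(d <- star) \sum_(e <- star) hC ^+ 2 / 5 * star_inv (- d) e *
    (fourier_mode h theta d * fourier_mode h theta e).

Lemma Ah_fourier theta x :
  Ah h (fourier_mode h theta) x = Ah_symbol theta * fourier_mode h theta x.
Proof.
rewrite AhE mulr_suml; apply: eq_bigr => d _.
by rewrite fourier_modeD; ring.
Qed.

(** The factor [c] allows the use on [Ah h] of a mode, which is a multiple of that mode. *)
Lemma Mv_fourier c theta x : Mv h (fun y => c * fourier_mode h theta y) x
  = c * Mv_symbol theta * fourier_mode h theta x.
Proof.
rewrite MvE mulr_sumr mulr_suml; apply: eq_bigr => d _.
rewrite mulr_sumr mulr_suml; apply: eq_bigr => e _.
by rewrite !fourier_modeD; ring.
Qed.

Lemma symbol_Ah theta : symbol h (Ah h) theta = Ah_symbol theta.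
Proof. by apply: symbol_eigen => x; rewrite Ah_fourier. Qed.

Lemma symbol_Mv theta : symbol h (Mv h) theta = Mv_symbol theta.
Proof.
apply: symbol_eigen => x; rewrite -[RHS](mul1r) mulrA -Mv_fourier.
by congr (Mv h _ x); apply/funext => y; rewrite mul1r.
Qed.

Lemma symbol_Sv omega theta : symbol h (Sv h omega) theta
  = 1 - omega%:C * symbol h (Mv h) theta * symbol h (Ah h) theta.
Proof.
apply: symbol_eigen => x; rewrite /Sv symbol_Mv symbol_Ah.
have -> : Ah h (fourier_mode h theta)
          = (fun y => Ah_symbol theta * fourier_mode h theta y).
  by apply/funext => y; rewrite Ah_fourier.
by rewrite Mv_fourier; ring.
Qed.

Lemma Mv_AhE theta : Mv_symbol theta * Ah_symbol theta =
  ((2 - (cos theta.1 + cos theta.2)) *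
   (16 + 4 * (cos theta.1 + cos theta.2) + (cos theta.1 + cos theta.2) ^+ 2)
   / 30)%:C.
Proof.
have hC0 : hC != 0 by rewrite fmorph_eq0.
have E d : fourier_mode h theta d = expi (theta.1 * d.1%:~R + theta.2 * d.2%:~R).
  by rewrite /fourier_mode /gridpt; congr expi; rewrite /=; field.
pose P := expi theta.1; pose Q := expi theta.2.
have P0 : fourier_mode h theta (1, 0) = P.
  by rewrite E /P/= mulr1 mulr0 addr0.
have Q0 : fourier_mode h theta (0, 1) = Q.
  by rewrite E /Q/= mulr1 mulr0 add0r.
have PP : P * fourier_mode h theta (-1, 0) = 1.
  by rewrite -P0 -fourier_modeD -[RHS](fourier_mode0 theta).
have QQ : Q * fourier_mode h theta (0, -1) = 1.
  by rewrite -Q0 -fourier_modeD -[RHS](fourier_mode0 theta).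
set P' := fourier_mode h theta (-1, 0) in PP.
set Q' := fourier_mode h theta (0, -1) in QQ.
have P'E : P + P' = (2 * cos theta.1)%:C.
  rewrite /P /P' E /= mulr0 addr0 mulrN1 /expi cosN sinN; simpc.
  by congr (_ +i* _); ring.
have Q'E : Q + Q' = (2 * cos theta.2)%:C.
  rewrite /Q /Q' E /= mulr0 add0r mulrN1 /expi cosN sinN; simpc.
  by congr (_ +i* _); ring.
have P_neq0 : P != 0.
  by apply: contra_eq_neq PP => ->; rewrite mul0r eq_sym oner_neq0.
have Q_neq0 : Q != 0.
  by apply: contra_eq_neq QQ => ->; rewrite mul0r eq_sym oner_neq0.
have P'V : P' = P^-1 by apply: (mulfI P_neq0); rewrite PP divff.
have Q'V : Q' = Q^-1 by apply: (mulfI Q_neq0); rewrite QQ divff.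
pose S := P + P' + (Q + Q').
(* The diagonal parts 1/4 occur for [e = - d] and add up to 1, since opposite modes multiply to 1.
   The rest is 1/3 + S/6 + S^2/48. *)
have ME : Mv_symbol theta = hC ^+ 2 / 60 * (16 + 2 * S + S ^+ 2 / 4).
  rewrite /Mv_symbol /star !big_cons !big_nil P0 Q0 fourier_mode0 -/P' -/Q'.
  rewrite /star_inv; eval_grid_eq; cbn [andb orb negb nat_of_bool].
  by rewrite /S P'V Q'V; field; apply/andP.
have AE : Ah_symbol theta = hC ^- 2 * (4 - S).
  rewrite /Ah_symbol /star !big_cons !big_nil P0 Q0 fourier_mode0 -/P' -/Q'.
  rewrite /laplacian_stencil fmorphV rmorphXn !inE.
  by eval_grid_eq; cbn [andb orb negb nat_of_bool]; rewrite /S; field.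
have SE : S = 2 * (cos theta.1 + cos theta.2)%:C.
  by rewrite /S P'E Q'E; ring.
rewrite ME AE SE; set t := cos theta.1 + cos theta.2.
by field.
Qed.

End VertexVanka.

(** * Bounds on the high frequencies and optimisation over the parameter *)

Lemma normc_real (R : realType) (x : R) : normc x%:C = `|x|.
Proof. by rewrite /normc /= expr0n addr0 sqrtr_sqr. Qed.

Lemma cos_le0 (R : realType) (x : R) : pi / 2 <= x <= 3 * pi / 2 -> cos x <= 0.
Proof.
move=> xpi; rewrite -[x](subrK pi) cosDpi oppr_le0.
by apply: cos_ge0_pihalf; lra.
Qed.

(** A high frequency has a component in [pi/2, 3pi/2), whose cosine is nonpositive. *)
Lemma cosD_Thigh (R : realType) (theta : R * R) : @Thigh R theta ->
  -2 <= cos theta.1 + cos theta.2 <= 1.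
Proof.
case: theta => x y [[/= /andP[x1 x2] /andP[y1 y2]]] nlow.
have [cx1 cx2] := (cos_geN1 x, cos_le1 x).
have [cy1 cy2] := (cos_geN1 y, cos_le1 y).
have [x3|x3] := leP (pi / 2) x.
  have := @cos_le0 _ x; rewrite x3 ltW// => /(_ isT); lra.
have [y3|y3] := leP (pi / 2) y.
  have := @cos_le0 _ y; rewrite y3 ltW// => /(_ isT); lra.
by exfalso; apply: nlow; rewrite /box /= x1 y1 x3 y3.
Qed.

Lemma cubic_bounds (R : realFieldType) (s : R) : -2 <= s <= 1 ->
  7 / 10 <= (2 - s) * (16 + 4 * s + s ^+ 2) / 30 <= 8 / 5.
Proof.
move=> /andP[s1 s2].
(* the gaps to the lower and the upper bound, times 30, factored *)
have h1 : 0 <= (1 - s) * (11 + 3 * s + s ^+ 2) by apply: mulr_ge0; nra.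
have h2 : 0 <= (s + 2) * (8 + s ^+ 2) by apply: mulr_ge0; nra.
by apply/andP; split; lra.
Qed.

(** The function [mu] records the maximum over the high frequencies, including that it is attained;
    the minimum over omega is then that of its range. *)
Theorem theorem3p5 (R : realType) (h : R) (h_gt0 : 0 < h) :
  (forall (omega : R) (theta : R * R),
     symbol h (Sv h omega) theta
     = 1 - omega%:C * symbol h (Mv h) theta * symbol h (Ah h) theta) /\
  exists mu : R -> R,
    [/\ forall omega : R,
          is_max [set normc (1 - omega%:C * symbol h (Mv h) theta
                                          * symbol h (Ah h) theta)
                 | theta in @Thigh R] (mu omega),
        is_min (range mu) (9 / 23)
      & forall omega : R, mu omega = 9 / 23 <-> omega = 20 / 23].
Proof.
have h_neq0 : h != 0 by rewrite gt_eqF.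
split; first by move=> *; exact: symbol_Sv.
pose g (s : R) := (2 - s) * (16 + 4 * s + s ^+ 2) / 30.
have symbE omega theta :
    normc (1 - omega%:C * symbol h (Mv h) theta * symbol h (Ah h) theta)
    = `|1 - omega * g (cos theta.1 + cos theta.2)|.
  rewrite symbol_Mv// symbol_Ah// -mulrA Mv_AhE// -normc_real.
  by congr normc; rewrite -/(g _); ring.
have pi0 : 0 < pi :> R := pi_gt0 R.
pose mu omega : R := Num.max `|1 - omega * (7 / 10)| `|1 - omega * (8 / 5)|.
have mu_ge omega : 9 / 23 <= mu omega /\ (mu omega <= 9 / 23 -> omega = 20 / 23).
  rewrite /mu le_max ge_max !ler_norml !ler_normr; split.
    (* Up to 20/23 the term with 7/10 is at least 1 - 14/23 = 9/23; beyond it the term with 8/5 is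
       at least 32/23 - 1 = 9/23. *)
    have [w|w] := leP omega (20 / 23).
      by apply/orP; left; apply/orP; left; lra.
    by apply/orP; right; apply/orP; right; lra.
  by move=> /andP[/andP[? ?] /andP[? ?]]; lra.
have mu_opt : mu (20 / 23) = 9 / 23.
  rewrite /mu [X in Num.max X]ger0_norm; last lra.
  by rewrite ler0_norm ?maxxx; last lra; rewrite max_l; lra.
exists mu; split.
- move=> omega; split.
    rewrite /mu; case: leP => _.
      exists (pi, pi); last first.
        by rewrite symbE /= cospi; congr (`|1 - omega * _|); rewrite /g; lra.
      by split; rewrite /box /=; [split; apply/andP; split|case=> /andP[]]; lra.
    exists (pi / 2, 0); last first.
      rewrite symbE /= cos_pihalf cos0.
      by congr (`|1 - omega * _|); rewrite /g; lra.
    by split; rewrite /box /=; [split; apply/andP; split|case=> /andP[]]; lra.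
  move=> _ [theta /cosD_Thigh/cubic_bounds g_bd <-]; rewrite symbE -/(g _) in g_bd *.
  set gs := g _ in g_bd *; case/andP: g_bd => g1 g2.
  have [mu1 mu2] : `|1 - omega * (7 / 10)| <= mu omega
                 /\ `|1 - omega * (8 / 5)| <= mu omega.
    by rewrite /mu !le_max !lexx orbT.
  move: mu1 mu2; rewrite !ler_norml => /andP[? ?] /andP[? ?].
  (* [1 - omega * gs] is affine in [gs], hence lies between its values at 7/10 and 8/5; the sign of
     omega decides their order. *)
  have [w|w] := leP 0 omega.
    have := ler_wpM2l w g1; have := ler_wpM2l w g2; lra.
  have := ler_wnM2l (ltW w) g1; have := ler_wnM2l (ltW w) g2; lra.
- split; first by exists (20 / 23).
  by move=> _ [omega _ <-]; have [] := mu_ge omega.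
- move=> omega; split=> [E|->//].
  by have [_] := mu_ge omega; apply; rewrite E.
Qed.
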